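(* Let $\mathbf A=(A_1,\ldots,A_n)\in G^n$ with $A_i=\begin{pmatrix}a_i&b_i\\0&1\end{pmatrix}$, and let $f,g\in\mathcal A_n=\mathbb F_q[x_1,\ldots,x_n]$. Then the following hold. (a) For any nonzero $f\in\mathcal A_n$, the polynomials $f$ and $\mathbf A\circ f$ have the same multidegree. (b) If $\mathbf I$ denotes the identity element of $G^n$, then $\mathbf I\circ f=f$. (c) $\mathbf A\circ(f\cdot g)=(\mathbf A\circ f)\cdot(\mathbf A\circ g)$. In particular, $\mathbf A\circ f$ is irreducible if and only if $f$ is irreducible. (d) Given $\mathbf A'\in G^n$, $\mathbf A'=(A_1',\ldots,A_n')$ with $A_i'=\begin{pmatrix}a_i'&b_i'\\0&1\end{pmatrix}$, we have $(\mathbf A'\mathbf A)\circ f=\mathbf A'\circ(\mathbf A\circ f)$. In particular, the endomorphism of $\mathcal A_n$ induced by $\mathbf A$ is an $\mathbb F_q$-automorphism of $\mathcal A_n$, with inverse induced by $\mathbf A^{-1}$. (e) The automorphism of $\mathcal A_n$ induced by $\mathbf A$ is of finite order, and its order coincides with the order of $\mathbf A$ in $G^n$.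
   Context: $\mathbb F_q$ is the finite field with $q$ elements, $q$ a power of a prime $p$, and $n\ge 1$. $G\le \mathrm{GL}_2(\mathbb F_q)$ is the subgroup of matrices $\begin{pmatrix}a&b\\0&1\end{pmatrix}$ with $a\in\mathbb F_q^*$, $b\in\mathbb F_q$; $G^n$ is the direct product of $n$ copies of $G$, with coordinate-wise matrix product. For $\mathbf A=(A_1,\ldots,A_n)\in G^n$ with $A_i=\begin{pmatrix}a_i&b_i\\0&1\end{pmatrix}$ and $f\in\mathcal A_n:=\mathbb F_q[x_1,\ldots,x_n]$, define $\mathbf A\circ f:=f(a_1x_1+b_1,\ldots,a_nx_n+b_n)$; the endomorphism induced by $\mathbf A$ is $f\mapsto\mathbf A\circ f$. The multidegree of a nonzero polynomial $f=\sum_{\alpha\in B}c_\alpha x_1^{\alpha_1}\cdots x_n^{\alpha_n}$ ($B$ finite, all $c_\alpha\ne0$) is the maximum of the $\alpha\in B$ for the graded lexicographical order: $\alpha>\alpha'$ if $\sum\alpha_i>\sum\alpha'_i$, or $\sum\alpha_i=\sum\alpha'_i$ and the leftmost nonzero coordinate of $\alpha-\alpha'$ is positive.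
   Formalization: In (d) the composition identity is proved as (AA')∘f = A'∘(A∘f) instead of (A'A)∘f = A'∘(A∘f), which fails with the given definitions, e.g. q=3, n=1, A=(2 0;0 1), A'=(1 1;0 1), f=x. *)

(* Defs.v *)
From mathcomp Require Export all_boot all_order all_algebra all_fingroup.
From mathcomp Require Export mpoly.

Set Implicit Arguments.
Unset Strict Implicit.
Unset Printing Implicit Defensive.

Import GRing.Theory.
Local Open Scope ring_scope.

Section AffineGroup.
Variable F : finFieldType.

(* The matrices [a b; 0 1] of GL_2(F); a != 0 is implied by invertibility. *)
Definition aff_set : {set {'GL_2[F]}} :=
  [set M : {'GL_2[F]} | ((M : 'M[F]_2) 1 0 == 0) && ((M : 'M[F]_2) 1 1 == 1)].

Lemma aff_group_set : group_set aff_set.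
Proof.
apply/group_setP; split=> [|M N]; first by rewrite inE GL_1E !mxE !eqxx.
rewrite !inE => /andP[/eqP M10 /eqP M11] /andP[/eqP N10 /eqP N11].
rewrite GL_ME !mxE !big_ord_recl !big_ord0 /=.
have e1 : lift ord0 ord0 = 1 :> 'I_2; first by apply/eqP.
have e0 : ord0 = 0 :> 'I_2; first by apply/eqP.
by rewrite e1 e0 M10 M11 N10 N11 !mul0r !mul1r !add0r !addr0 !eqxx.
Qed.

Canonical aff_group := Group aff_group_set.

Definition aff_a (M : {'GL_2[F]}) : F := (M : 'M[F]_2) 0 0.
Definition aff_b (M : {'GL_2[F]}) : F := (M : 'M[F]_2) 0 1.

Definition aff_power (n : nat) :
  {group {dffun forall i : 'I_n, {'GL_2[F]}}} :=
  setXn_group (fun _ : 'I_n => aff_group).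

(* f (a_1 x_1 + b_1, ..., a_n x_n + b_n).  Acting by A and then by A'
   substitutes a_i (a'_i x_i + b'_i) + b_i for x_i, whose coefficients are the
   top row of A_i A'_i (in this order): this is a right action. *)
Definition aff_act (n : nat) (A : {dffun forall i : 'I_n, {'GL_2[F]}})
    (f : {mpoly F[n]}) : {mpoly F[n]} :=
  f \mPo [tuple aff_a (A i) *: 'X_i + (aff_b (A i))%:MP_[n] | i < n].

End AffineGroup.

Definition irreducible (R : idomainType) (p : R) : Prop :=
  [/\ p != 0, p \isn't a GRing.unit &
      forall u v : R, p = u * v -> u \is a GRing.unit \/ v \is a GRing.unit].

Definition alg_automorphism (R : comNzRingType) (U : algType R) (h : U -> U)
    : Prop :=
  [/\ linear h, monoid_morphism h & bijective h].

(* The order of h for composition. *)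
Definition has_order (T : Type) (h : T -> T) (k : nat) : Prop :=
  [/\ (0 < k)%N, iter k h =1 id &
      forall m : nat, (0 < m)%N -> iter m h =1 id -> (k <= m)%N].

(* Main.v *)
(* The action is contravariant: (A A') acts as A' after A, so acting by A^-1
   inverts acting by A, and everything about automorphisms follows.  Since
   a x_i + b has leading monomial at most x_i, acting by any A cannot raise the
   multidegree; applying this to A^-1 as well gives equality.  The action is
   faithful because A is read off the images of the variables, hence the order
   of the automorphism is that of A. *)
From HB Require Import structures.
From mathcomp Require Import cyclic.
Require Import Defs.

Set Implicit Arguments.
Unset Strict Implicit.
Unset Printing Implicit Defensive.

Import GRing.Theory.
Import Order.TTheory.
Local Open Scope ring_scope.

(** A factorisation of [h p] is carried by [g] to one of [p], and ring morphisms send units to units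
    in both directions. *)
Lemma irreducible_iso (R : idomainType) (h g : {rmorphism R -> R}) (p : R) :
  cancel h g -> cancel g h -> irreducible p -> irreducible (h p).
Proof.
move=> hK gK [p0 pU pI]; split.
- by rewrite -(rmorph0 h) (inj_eq (can_inj hK)).
- by apply: contra pU => /(rmorph_unit g); rewrite hK.
move=> u v /(congr1 g); rewrite hK rmorphM => /pI[] /(rmorph_unit h).
  by rewrite gK; left.
by rewrite gK; right.
Qed.

Section AffineAction.
Context (F : finFieldType) (n : nat).
Implicit Types (A B : {dffun forall i : 'I_n, {'GL_2[F]}}) (f : {mpoly F[n]}).

HB.instance Definition _ A := GRing.LRMorphism.copy (aff_act A)
  (comp_mpoly [tuple aff_a (A i) *: 'X_i + (aff_b (A i))%:MP_[n] | i < n]).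

Lemma aff_actXU A i :
  aff_act A 'X_i = aff_a (A i) *: 'X_i + (aff_b (A i))%:MP_[n].
Proof. by rewrite /aff_act comp_mpolyXU -tnth_nth tnth_mktuple. Qed.

Lemma aff_actC A c : aff_act A c%:MP_[n] = c%:MP_[n].
Proof. exact: comp_mpolyC. Qed.

Lemma aff_actX A m : aff_act A 'X_[m] = \prod_(i < n) aff_act A 'X_i ^+ m i.
Proof. by rewrite mpolyXE_id rmorph_prod; apply: eq_bigr => i _; rewrite rmorphXn. Qed.

(** Monomials are products of powers of variables and span linearly; identities between actions thus
    reduce to affine forms in one variable. *)
Lemma eq_on_vars (g h : {lrmorphism {mpoly F[n]} -> {mpoly F[n]}}) :
  (forall i, g 'X_i = h 'X_i) -> g =1 h.
Proof.
move=> gh f; rewrite [f]mpolyE !linear_sum; apply: eq_bigr => m _.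
rewrite !linearZ /= mpolyXE_id !rmorph_prod; congr (_ *: _).
by apply: eq_bigr => i _; rewrite !rmorphXn /= gh.
Qed.

Lemma aff_act1 f : aff_act 1%g f = f.
Proof.
(* Reading [f] as [idfun f] exhibits the right-hand side as an algebra morphism. *)
rewrite -[RHS]/(idfun f); apply: eq_on_vars => i /=.
by rewrite aff_actXU ffunE /aff_a /aff_b GL_1E !mxE scale1r mpolyC0 addr0.
Qed.

Lemma aff_powerP A :
  reflect (forall i, (A i : 'M[F]_2) 1 0 = 0 /\ (A i : 'M[F]_2) 1 1 = 1)
          (A \in aff_power F n).
Proof.
apply: (iffP setXnP) => [hA i | hA i].
  by have := hA i; rewrite inE => /andP[/eqP-> /eqP->].
by rewrite inE; have [-> ->] := hA i; rewrite !eqxx.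
Qed.

(** As [B i] has bottom row (0, 1), the top row of the matrix product of [A i] and [B i] is (a a', a
    b' + b), matching a (a' x + b') + b. *)
Lemma aff_actM A B f : B \in aff_power F n ->
  aff_act (A * B)%g f = aff_act B (aff_act A f).
Proof.
move=> /aff_powerP hB; have -> : aff_act B (aff_act A f) = (aff_act B \o aff_act A) f by [].
apply: eq_on_vars => i /=; have [B10 B11] := hB i.
rewrite !aff_actXU linearD linearZ /= aff_actC aff_actXU ffunE.
have e1 : lift ord0 ord0 = 1 :> 'I_2 by apply/eqP.
rewrite /aff_a /aff_b GL_ME !mxE !big_ord_recl !big_ord0 /= e1 B10 B11.
by rewrite mulr0 mulr1 !addr0 scalerDr scalerA -addrA mpolyCD mpolyCM mul_mpolyC.
Qed.

Lemma aff_actK A : A \in aff_power F n ->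
  cancel (aff_act A) (aff_act A^-1%g).
Proof. by move=> hA f; rewrite -aff_actM ?groupV // mulgV aff_act1. Qed.

Lemma aff_actKV A : A \in aff_power F n ->
  cancel (aff_act A^-1%g) (aff_act A).
Proof. by move=> hA f; rewrite -aff_actM // mulVg aff_act1. Qed.

Lemma mlead_aff_act_le A f : (mlead (aff_act A f) <= mlead f)%O.
Proof.
rewrite {1}[f]mpolyE linear_sum.
apply: le_trans (mlead_sum_le _ _ _) _; apply/joinsP_seq => m mf _.
rewrite linearZ /=; apply: le_trans (mleadZ_le _ _) _.
apply: le_trans (msupp_le_mlead mf); rewrite aff_actX.
apply: le_trans (mlead_prod_le _ _ _) _.
(* With [m] written as the sum of the [U_(i) *+ m i], the bound is checked one variable at a time,
   since the order is compatible with addition. *)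
rewrite [leRHS]multinomUE_id.
apply: (big_ind2 (fun m1 m2 : 'X_{1..n} => (m1 <= m2)%O)) => // [*|i _].
  exact: lem_add.
apply: le_trans (mleadX_le _ _) _; elim: (m i) => [|k IHk].
  by rewrite !mulm0n.
rewrite !mulmS; apply: lem_add IHk.
rewrite aff_actXU; apply: le_trans (mleadD_le _ _) _.
(* The constant term leads with [0], the bottom of the monomial order, so it drops out of the
   join. *)
rewrite mleadC joinx0; apply: le_trans (mleadZ_le _ _) _.
by rewrite mleadXm.
Qed.

Lemma mlead_aff_act A f : A \in aff_power F n ->
  mlead (aff_act A f) = mlead f.
Proof.
move=> hA; apply: le_anti; rewrite mlead_aff_act_le /=.
by rewrite -{1}(aff_actK hA f) mlead_aff_act_le.
Qed.

Lemma aff_act_faithful A : A \in aff_power F n -> aff_act A =1 id -> A = 1%g.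
Proof.
move=> /aff_powerP hA Aid; apply/ffunP => i; rewrite ffunE.
have [A10 A11] := hA i; have := Aid 'X_i; rewrite aff_actXU => e.
(* Comparing coefficients at [U_(i)] and at [0] gives a = 1 and b = 0. *)
have := congr1 (mcoeff 0%MM) e; have := congr1 (mcoeff U_(i)%MM) e.
rewrite !mcoeffD !mcoeffZ !mcoeffX !mcoeffC !eqxx mnm1_eq0.
rewrite !mulr0 !mulr1 addr0 add0r => a1 b0.
apply: val_inj; apply/matrixP => j k; rewrite /= mxE.
have I2P (l : 'I_2) : l = 0 \/ l = 1.
  by case: l => [[|[|]]] //= l2; [left | right]; apply: val_inj.
by case: (I2P j) => ->; case: (I2P k) => ->.
Qed.

Lemma iter_aff_act A k f : A \in aff_power F n ->
  iter k (aff_act A) f = aff_act (A ^+ k)%g f.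
Proof.
move=> hA; elim: k => [|k IHk]; first by rewrite aff_act1.
by rewrite iterS IHk -aff_actM // expgSr.
Qed.

Lemma has_order_aff_act A : A \in aff_power F n -> has_order (aff_act A) #[A]%g.
Proof.
move=> hA; split; first exact: order_gt0.
  by move=> f; rewrite iter_aff_act // expg_order aff_act1.
(* Minimality: by faithfulness, a positive iterate equal to the identity forces the same power of
   [A] to be 1. *)
move=> [//|m] _ mA; apply/order_inf/eqP.
by apply: aff_act_faithful => [|f]; rewrite ?groupX // -iter_aff_act // mA.
Qed.

End AffineAction.

Theorem lemma2p4 (F : finFieldType) (n : nat) (hn : (0 < n)%N)
    (A : {dffun forall i : 'I_n, {'GL_2[F]}}) (hA : A \in aff_power F n) :
  [/\ (* (a) *)
      forall f : {mpoly F[n]}, f != 0 ->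
        aff_act A f != 0 /\ mlead (aff_act A f) = mlead f,
      (* (b) *)
      forall f : {mpoly F[n]}, aff_act 1%g f = f,
      (* (c) *)
      (forall f g : {mpoly F[n]},
         aff_act A (f * g) = aff_act A f * aff_act A g) /\
      (forall f : {mpoly F[n]}, irreducible (aff_act A f) <-> irreducible f),
      (* (d) *)
      (forall A' : {dffun forall i : 'I_n, {'GL_2[F]}}, A' \in aff_power F n ->
         forall f : {mpoly F[n]},
           aff_act (A * A')%g f = aff_act A' (aff_act A f)) /\
      [/\ alg_automorphism (aff_act A),
          cancel (aff_act A) (aff_act A^-1%g) &
          cancel (aff_act A^-1%g) (aff_act A)]
    & (* (e) *)
      has_order (aff_act A) #[A]%g].
Proof.
split.
- move=> f f0; split; last exact: mlead_aff_act.
  by rewrite -(rmorph0 (aff_act A)) (inj_eq (can_inj (aff_actK _))).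
- exact: aff_act1.
- split=> [f g | f]; first exact: rmorphM.
  split; last exact: irreducible_iso (aff_actK hA) (aff_actKV hA).
  (* Transport along the action of the inverse, which returns [aff_act A f] to [f]. *)
  move=> /(irreducible_iso (aff_actKV hA) (aff_actK hA)).
  by rewrite /= aff_actK.
- split=> [A' hA' f |]; first exact: aff_actM.
  split; [split | exact: aff_actK | exact: aff_actKV].
  + exact: linearP.
  + split; [exact: rmorph1 | exact: rmorphM].
  + by exists (aff_act A^-1%g); [exact: aff_actK | exact: aff_actKV].
- exact: has_order_aff_act.
Qed.
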